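(* Let $R=\prod_{i=1}^{q}R_i/N_iR_i$, where each $R_i$ is a principal ideal domain and $N_i\in R_i$ is not a unit (possibly $N_i=0$). Let $S=R[x_1,\dots,x_n]$ and let $M$ be a finitely generated $S$-module. Suppose $M\cong F/U$, where $F=\bigoplus_{i=1}^rS$ is a finitely generated free $S$-module and $U\subseteq F$ is a submodule which, with respect to some monomial order on $F$, has a Gröbner basis all of whose elements have leading coefficients that are nonzerodivisors in $R$. Then $M$ admits a free $S$-resolution $$0\to F_p\to F_{p-1}\to\dots\to F_1\to F_0\to M\to 0$$ of length $p\le n+1$.
   Context: Let $e_1,\dots,e_r$ be the standard basis of $F$. A monomial of $F$ is an element $ue_i$ with $u$ a monomial of $S$. A monomial order on $F$ is a total order $>$ on the monomials of $F$ such that $wm>m$ for every monomial $m$ of $F$ and every monomial $w\ne1$ of $S$, and such that $m>m'$ implies $wm>wm'$. For $0\neq f\in F$ whose largest monomial is $ue_i$, with coefficient $a\neq 0$, the leading term is $\operatorname{LT}(f)=aue_i$ and the leading coefficient is $\operatorname{lc}(f)=a$. $\operatorname{LT}(U)$ is the $S$-submodule of $F$ generated by the leading terms of the elements of $U$. A finite set $\{f_1,\dots,f_m\}\subseteq U$ is a Gröbner basis of $U$ if $\langle\operatorname{LT}(f_1),\dots,\operatorname{LT}(f_m)\rangle=\operatorname{LT}(U)$. *)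

(* Defs.v *)
From HB Require Import structures.
From mathcomp Require Import all_boot all_order all_algebra.
From mathcomp.classical Require Import boolp.
From mathcomp.multinomials Require Import mpoly.

Set Implicit Arguments.
Unset Strict Implicit.
Unset Printing Implicit Defensive.

Import GRing.Theory.
Local Open Scope ring_scope.
Local Open Scope quotient_scope.

Definition is_pid (A : idomainType) : Prop :=
  forall I : A -> Prop,
    I 0 -> (forall x y, I x -> I y -> I (x + y)) ->
    (forall a x, I x -> I (a * x)) ->
  exists g, forall x, I x <-> exists a, x = a * g.

(* The proof that N is not a unit is an argument because MathComp only forms
   ring quotients by proper ideals. *)
Section PrincipalQuotient.
Variables (A : comUnitRingType) (N : A) (hN : N \isn't a GRing.unit).

Definition principal_ideal of N \isn't a GRing.unit : A -> bool :=
  fun x => `[< exists a, x = a * N >].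

Lemma principal_ideal_closed : idealr_closed (principal_ideal hN).
Proof.
split.
- by apply/asboolP; exists 0; rewrite mul0r.
- apply/asboolP => -[a aN]; move/negP: hN; apply.
  by apply/unitrPr; exists a; rewrite mulrC -aN.
- move=> a _ _ /asboolP[b ->] /asboolP[c ->]; apply/asboolP.
  by exists (a * b + c); rewrite mulrDl mulrA.
Qed.

HB.instance Definition _ :=
  isIdealr.Build A (principal_ideal hN) principal_ideal_closed.

Definition principal_quotient : comNzRingType :=
  {ideal_quot (principal_ideal hN : idealr A)}.
End PrincipalQuotient.

(* The number of factors is q.+1: the empty product is the zero ring, which is
   not a comNzRingType. *)
Definition prod_ring (q : nat) (T : 'I_q.+1 -> comNzRingType) : Type :=
  {dffun forall i, T i}.

Section ProdRing.
Variables (q : nat) (T : 'I_q.+1 -> comNzRingType).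
Implicit Types f g : prod_ring T.

HB.instance Definition _ := Choice.on (prod_ring T).

Definition prod_zero : prod_ring T := [ffun i => 0 : T i].
Definition prod_one : prod_ring T := [ffun i => 1 : T i].
Definition prod_opp f : prod_ring T := [ffun i => - f i : T i].
Definition prod_add f g : prod_ring T := [ffun i => f i + g i : T i].
Definition prod_mul f g : prod_ring T := [ffun i => f i * g i : T i].

Fact prod_addA : associative prod_add.
Proof. by move=> f g h; apply/ffunP => i; rewrite !ffunE addrA. Qed.
Fact prod_addC : commutative prod_add.
Proof. by move=> f g; apply/ffunP => i; rewrite !ffunE addrC. Qed.
Fact prod_add0 : left_id prod_zero prod_add.
Proof. by move=> f; apply/ffunP => i; rewrite !ffunE add0r. Qed.
Fact prod_addN : left_inverse prod_zero prod_opp prod_add.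
Proof. by move=> f; apply/ffunP => i; rewrite !ffunE addNr. Qed.

HB.instance Definition _ := GRing.isZmodule.Build (prod_ring T)
  prod_addA prod_addC prod_add0 prod_addN.

Fact prod_mulA : associative prod_mul.
Proof. by move=> f g h; apply/ffunP => i; rewrite !ffunE mulrA. Qed.
Fact prod_mulC : commutative prod_mul.
Proof. by move=> f g; apply/ffunP => i; rewrite !ffunE mulrC. Qed.
Fact prod_mul1 : left_id prod_one prod_mul.
Proof. by move=> f; apply/ffunP => i; rewrite !ffunE mul1r. Qed.
Fact prod_mulDl : left_distributive prod_mul +%R.
Proof. by move=> f g h; apply/ffunP => i; rewrite !ffunE mulrDl. Qed.
Fact prod_one_neq0 : prod_one != 0.
Proof.
by apply/eqP => /ffunP/(_ ord0)/eqP; rewrite !ffunE oner_eq0.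
Qed.

HB.instance Definition _ := GRing.Zmodule_isComNzRing.Build (prod_ring T)
  prod_mulA prod_mulC prod_mul1 prod_mulDl prod_one_neq0.
End ProdRing.

Section Submodules.
Variables (S : nzRingType) (V : lmodType S).

Definition span (A : V -> Prop) (v : V) : Prop :=
  exists k (c : 'I_k -> S) (x : 'I_k -> V),
    (forall i, A (x i)) /\ v = \sum_(i < k) c i *: x i.

Definition finitely_generated : Prop :=
  exists g : seq V, forall v, span (fun x => x \in g) v.

Definition is_basis (B : {pred V}) : Prop :=
  (forall v, span (fun x => x \in B) v) /\
  (forall (s : seq V) (c : V -> S), uniq s -> {subset s <= B} ->
     \sum_(x <- s) c x *: x = 0 -> {in s, forall x, c x = 0}).

Definition is_free : Prop := exists B : {pred V}, is_basis B.
End Submodules.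

(* An alias of U carrying the additive subgroup structure that the library's
   quotients require; closure under opposite comes from scaling by -1. *)
Section QuotientModule.
Variables (S : nzRingType) (V : lmodType S) (U : submodClosed V).

Definition submod_pred (W : submodClosed V) : V -> bool := fun x => x \in W.

Fact submod_pred_zmod : zmod_closed (submod_pred U).
Proof. exact: GRing.submod_closedB (GRing.submodClosedP U). Qed.

HB.instance Definition _ :=
  GRing.isZmodClosed.Build V (submod_pred U) submod_pred_zmod.

Definition submod_zmod : zmodClosed V :=
  GRing.ZmodClosed.clone V (submod_pred U) _.

Definition quotmod : Type := Quotient.quot submod_zmod.

HB.instance Definition _ := GRing.Zmodule.on quotmod.

Definition quotmod_pi (v : V) : quotmod := \pi v.
Definition quotmod_scale (a : S) (x : quotmod) : quotmod :=
  quotmod_pi (a *: repr x).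

Fact quotmod_piD : {morph quotmod_pi : x y / x + y}.
Proof. exact: Quotient.pi_add. Qed.

Fact quotmod_piE x y : (quotmod_pi x == quotmod_pi y) = (x - y \in U).
Proof. by rewrite /quotmod_pi -Quotient.idealrBE. Qed.

Fact quotmod_reprK : cancel (fun x : quotmod => repr x) quotmod_pi.
Proof. exact: reprK. Qed.

Fact quotmod_piZ a v : quotmod_scale a (quotmod_pi v) = quotmod_pi (a *: v).
Proof.
apply/eqP; rewrite quotmod_piE -scalerBr rpredZ // -quotmod_piE.
by rewrite quotmod_reprK.
Qed.

Fact quotmod_scaleA a b v :
  quotmod_scale a (quotmod_scale b v) = quotmod_scale (a * b) v.
Proof. by rewrite -[v]quotmod_reprK !quotmod_piZ scalerA. Qed.

Fact quotmod_scale1 : left_id 1 quotmod_scale.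
Proof. by move=> v; rewrite -[v]quotmod_reprK quotmod_piZ scale1r. Qed.

Fact quotmod_scaleDr : right_distributive quotmod_scale +%R.
Proof.
move=> a v w; rewrite -[v]quotmod_reprK -[w]quotmod_reprK.
by rewrite -quotmod_piD !quotmod_piZ scalerDr quotmod_piD.
Qed.

Fact quotmod_scaleDl v : {morph quotmod_scale^~ v : a b / a + b}.
Proof.
move=> a b; rewrite -[v]quotmod_reprK !quotmod_piZ.
by rewrite scalerDl quotmod_piD.
Qed.

HB.instance Definition _ := GRing.Zmodule_isLmodule.Build S quotmod
  quotmod_scaleA quotmod_scale1 quotmod_scaleDr quotmod_scaleDl.
End QuotientModule.

Section Groebner.
Variables (R : comNzRingType) (n r : nat).
Local Notation F := 'rV[{mpoly R[n]}]_r.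

(* The pair (u, i) stands for the monomial u e_i. *)
Definition monomial : Type := ('X_{1..n} * 'I_r)%type.

Definition mon_mul (w : 'X_{1..n}) (m : monomial) : monomial :=
  ((w + m.1)%MM, m.2).

Definition monomial_order (gt : rel monomial) : Prop :=
  [/\ irreflexive gt, transitive gt &
      forall m m', m != m' -> gt m m' || gt m' m] /\
  [/\ forall w m, w != 0%MM -> gt (mon_mul w m) m &
      forall w m m', gt m m' -> gt (mon_mul w m) (mon_mul w m')].

Definition fsupp (f : F) : seq monomial :=
  [seq (u, i) | i <- enum 'I_r, u <- msupp (f 0 i)].

(* The largest monomial of f, or None when f = 0. *)
Definition lead_mon (gt : rel monomial) (f : F) : option monomial :=
  ohead (sort (fun m m' => (m == m') || gt m m') (fsupp f)).

(* With the convention that the leading coefficient and term of 0 are 0. *)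
Definition lc (gt : rel monomial) (f : F) : R :=
  if lead_mon gt f is Some (u, i) then (f 0 i)@_u else 0.

Definition LT (gt : rel monomial) (f : F) : F :=
  if lead_mon gt f is Some (u, i) then
    (lc gt f *: 'X_[u]) *: delta_mx 0 i
  else 0.

Definition LT_module (gt : rel monomial) (A : F -> Prop) : F -> Prop :=
  span (fun t => exists f, A f /\ t = LT gt f).

Definition groebner_basis (gt : rel monomial) (U : submodClosed F)
    (G : seq F) : Prop :=
  {subset G <= U} /\
  (forall t, LT_module gt (fun f => f \in G) t <->
             LT_module gt (fun f => f \in U) t).

Lemma mem_fsupp (f : F) m : (m \in fsupp f) = ((f 0 m.2)@_m.1 != 0).
Proof.
case: m => u i; rewrite /= -mcoeff_msupp; apply/allpairsPdep/idP.
  by case=> j [v [_ vf [-> ->]]].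
by move=> uf; exists i, u; rewrite mem_enum.
Qed.

Lemma lead_monP gt (f : F) m : monomial_order gt ->
  lead_mon gt f = Some m ->
  (f 0 m.2)@_m.1 != 0 /\
  forall m', (f 0 m'.2)@_m'.1 != 0 -> m' = m \/ gt m m'.
Proof.
case=> -[irr tr tot] _; rewrite /lead_mon; set e := (X in sort X) => lm.
have e_tr : transitive e.
  move=> y x z /predU1P[->//|xy] /predU1P[<-|yz]; first by rewrite /e xy orbT.
  by rewrite /e (tr _ _ _ xy yz) orbT.
have e_tot : total e.
  move=> x y; rewrite /e; by have [//|/tot] := eqVneq x y.
have := sort_sorted e_tot (fsupp f); have := mem_sort e (fsupp f).
case: (sort e (fsupp f)) lm => [//|m0 s] [->] ms.
rewrite /= (path_sortedE e_tr) => /andP[/allP ms_le _].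
split; first by rewrite -mem_fsupp -ms mem_head.
move=> m'; rewrite -mem_fsupp -ms inE => /predU1P[|/ms_le /predU1P[]]; by auto.
Qed.

Lemma lead_mon_eq0 gt (f : F) : (lead_mon gt f == None) = (f == 0).
Proof.
rewrite /lead_mon; set e := (X in sort X).
have -> : (ohead (sort e (fsupp f)) == None) = (fsupp f == [::]).
  by rewrite -!size_eq0 -(size_sort e); case: (sort _ _).
apply/eqP/eqP => [f0|->]; last first.
  case: (fsupp _) (mem_fsupp 0) => [//|m s] /(_ m).
  by rewrite mem_head mxE mcoeff0 eqxx.
apply/rowP => i; apply/mpolyP => u; rewrite mxE mcoeff0; apply/eqP.
by apply/negPn; rewrite -(mem_fsupp f (u, i)) f0.
Qed.
End Groebner.

Section Resolutions.
Variables (S : nzRingType) (M : lmodType S).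

Definition exact_at (A B C : lmodType S) (f : A -> B) (g : B -> C) : Prop :=
  forall y, g y = 0 <-> exists x, f x = y.

(* The finite complex is extended by P i = 0 for i > p, so that exactness at
   P p is injectivity of the map out of P p. *)
Definition free_resolution (p : nat) (P : nat -> lmodType S)
    (d : forall i, {linear P i.+1 -> P i}) (eps : {linear P 0%N -> M}) : Prop :=
  [/\ forall i, is_free (P i),
      forall i, (p < i)%N -> forall x : P i, x = 0,
      forall i, exact_at (d i.+1) (d i),
      exact_at (d 0%N) eps &
      forall y, exists x, eps x = y].

Definition has_free_resolution (p : nat) : Prop :=
  exists (P : nat -> lmodType S) (d : forall i, {linear P i.+1 -> P i})
    (eps : {linear P 0%N -> M}), free_resolution p d eps.
End Resolutions.

(* Main.v *)
Require Import Defs.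
From HB Require Import structures.
From mathcomp Require Import all_boot all_order all_algebra.
From mathcomp.classical Require Import boolp.
From mathcomp.multinomials Require Import mpoly.

(** The proof is Schreyer's construction of syzygies, run over a ring in which
    two elements always have a greatest common divisor given by a Bezout
    identity.  Quotients of principal ideal domains have this property, and it
    passes to finite products, so R has it.

    For a submodule U of F and a monomial mu, let I(mu) be the ideal of the
    coefficients at mu of the elements of U that have no monomial larger than
    mu.  A Groebner basis g_1, ..., g_t with leading terms c_j m_j says that
    I(mu) is generated by the c_j with m_j dividing mu [groebner_lead_basis].
    The division algorithm, which terminates by Dickson's lemma, shows that
    the g_j generate U [division].  Order the monomials w e_j of the free
    module on the g_j by comparing w m_j, ties being broken by an order of the
    indices.  Then for the kernel K of the map from that free module onto U,

      I_K(w e_j) = (c_k : k comes after j and m_k divides w m_j) : c_j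

    where one inclusion is the vanishing of the coefficient at w m_j of the
    image of a kernel element [syzygy_lead], and the other lifts a relation
    between the c's to a relation between the g's by division [syzygy_exists].
    As all the c's are nonzerodivisors, the Bezout property makes a nonzero
    ideal of this form principal, generated by a nonzerodivisor
    [bezout_colon].  It depends only on which m_k divide w m_j, so K has a
    finite Groebner basis of the same kind, whose monomials are w e_j with w
    the least common multiple of some of the m_k, divided by m_j.

    If ties are broken by decreasing exponent of the next variable in the m_j,
    that variable does not occur in these w, and the variables treated before
    do not reappear [syzygy_step].  After n steps the leading monomials
    contain no variable; one generator per basis vector then suffices, and
    such generators have no syzygies [lead_basis_constant, syzygy_eq0].
    Counting F itself, the resolution has length n + 1. *)

Set Implicit Arguments.
Unset Strict Implicit.
Unset Printing Implicit Defensive.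

Import GRing.Theory.
Local Open Scope ring_scope.

Local Notation span := Defs.span.

(** * Spans and Bezout rings *)

Section Span.
Variables (S : nzRingType) (V : lmodType S).
Implicit Types (A : V -> Prop) (u v : V).

Lemma span_mem A x : A x -> span A x.
Proof.
by move=> Ax; exists 1%N, (fun=> 1), (fun=> x); rewrite big_ord1 scale1r.
Qed.

Lemma span0 A : span A 0.
Proof.
by exists 0%N, (fun=> 0), (fun=> 0); rewrite big_ord0; split=> // -[].
Qed.

Lemma spanZD A a u v : span A u -> span A v -> span A (a *: u + v).
Proof.
move=> [k [c [x [Ax ->]]]] [l [d [y [Ay ->]]]].
pose pick T (f : 'I_k -> T) (g : 'I_l -> T) i :=
  match split i with inl i1 => f i1 | inr i2 => g i2 end.
exists (k + l)%N, (pick _ (fun i => a * c i) d), (pick _ x y); split.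
  by move=> i; rewrite /pick; case: split.
rewrite big_split_ord /= scaler_sumr; congr (_ + _).
  apply: eq_bigr => i _; rewrite /pick.
  by rewrite (unsplitK (inl i : 'I_k + 'I_l)) scalerA.
apply: eq_bigr => i _; rewrite /pick.
by rewrite (unsplitK (inr i : 'I_k + 'I_l)).
Qed.

Lemma spanZ A a u : span A u -> span A (a *: u).
Proof.
by move=> Au; rewrite -[_ *: _]addr0; apply: spanZD => //; apply: span0.
Qed.

Lemma span_sum A (I : Type) (s : seq I) (P : pred I) (f : I -> V) :
  (forall i, P i -> span A (f i)) -> span A (\sum_(i <- s | P i) f i).
Proof.
move=> Af; elim/big_rec: _ => [|i v /Af Ai Av]; first exact: span0.
by rewrite -[f i]scale1r; apply: spanZD.
Qed.

Lemma span_least A (W : V -> Prop) :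
    W 0 -> (forall a u v, W u -> W v -> W (a *: u + v)) ->
    (forall x, A x -> W x) ->
  forall v, span A v -> W v.
Proof.
move=> W0 WZD AW v [k [c [x [Ax ->]]]].
by elim/big_rec: _ => // i u _; apply: WZD; apply: AW.
Qed.

(** Gathers the repeated generators of a span, so that each index of a finite
    family occurs with one coefficient. *)
Lemma span_family A (I : finType) (P : pred I) (x : I -> V) :
    (forall y, A y -> exists2 i, P i & y = x i) ->
  forall v, span A v -> exists b : I -> S, v = \sum_(i | P i) b i *: x i.
Proof.
move=> Ax; apply: span_least => [|a u v [b ->] [b' ->]|y /Ax[i Pi ->]].
- by exists (fun=> 0); rewrite big1 // => i _; rewrite scale0r.
- exists (fun i => a * b i + b' i); rewrite scaler_sumr -big_split /=.
  by apply: eq_bigr => i _; rewrite scalerDl scalerA.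
- exists (fun j => (j == i)%:R); rewrite (bigD1 i) //= eqxx scale1r.
  rewrite big1 ?addr0 //.
  by move=> j /andP[_ /negPf->]; rewrite scale0r.
Qed.
End Span.

(** Every finitely generated ideal is principal, stated for two generators
    together with the cofactors, so that it passes to quotients and finite
    products. *)
Definition bezout_ring (R : comNzRingType) : Prop :=
  forall a b : R, exists d x y u v,
    [/\ d = x * a + y * b, a = u * d & b = v * d].

Section Bezout.
Variables (R : comNzRingType) (bezR : bezout_ring R).

Lemma bezout_seq (s : seq R) : exists d : R,
  span (fun x : R^o => x \in s) d /\ forall x, x \in s -> exists y, x = y * d.
Proof.
elim: s => [|a s [d [sd d_dvd]]]; first by exists 0; split=> //; apply: span0.
have [e [x [y [u [v [eE aE dE]]]]]] := bezR a d; exists e; split.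
  rewrite eE; apply: spanZD; first by apply: span_mem; rewrite mem_head.
  apply: spanZ; move: sd; apply: span_least.
  - exact: span0.
  - by move=> *; apply: spanZD.
  - by move=> z zs; apply: span_mem; rewrite inE zs orbT.
move=> z; rewrite inE => /predU1P[->|/d_dvd[w ->]]; first by exists u.
by exists (w * v); rewrite -mulrA -dE.
Qed.

(** The ideal generated by s is (d) with d a nonzerodivisor.  If g generates
    (d, c), with d = d' g and c = c' g, then c' is invertible modulo d', hence
    (d) : (c) = (d'). *)
Lemma bezout_colon (s : seq R) (c : R) :
    s != [::] -> {in s, forall x, GRing.lreg x} -> GRing.lreg c ->
  exists a, [/\ GRing.lreg a, span (fun x : R^o => x \in s) (a * c) &
    forall x, span (fun y : R^o => y \in s) (x * c) -> exists y, x = y * a].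
Proof.
move=> s_neq0 s_reg c_reg; have [d [sd d_dvd]] := bezout_seq s.
have d_reg: GRing.lreg d.
  case: s s_neq0 s_reg d_dvd {sd} => // a s _ /(_ a (mem_head _ _)) a_reg.
  case/(_ a (mem_head _ _)) => y aE; move: a_reg.
  by rewrite aE; apply: GRing.lregMl.
have [g [x0 [y0 [d' [c' [gE dE cE]]]]]] := bezR d c.
have g_reg: GRing.lreg g by move: d_reg; rewrite dE; apply: GRing.lregMl.
exists d'; split.
- by move: d_reg; rewrite dE mulrC; apply: GRing.lregMl.
- by rewrite cE mulrCA -dE; apply: spanZ.
have one: x0 * d' + y0 * c' = 1.
  apply: g_reg; rewrite mulr1 [RHS]gE [in RHS]dE [in RHS]cE.
  by rewrite mulrC mulrDl !mulrA.
have span_dvd v : span (fun y : R^o => y \in s) v -> exists z, v = z * d.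
  move: v; apply: span_least => [|a u v [z ->] [w ->]|w /d_dvd//].
  - by exists 0; rewrite mul0r.
  - by exists (a * z + w); rewrite mulrDl -mulrA.
move=> x /span_dvd[z xcE].
exists (x0 * x + y0 * z).
have xc'E : x * c' = z * d'.
  by apply: g_reg; rewrite ![g * _]mulrC -!mulrA -cE -dE.
rewrite mulrDl -[y0 * z * _]mulrA -xc'E -[LHS]mulr1 -one mulrDr.
rewrite [x * (y0 * _)]mulrCA [x * (x0 * _)]mulrCA.
by rewrite (mulrA x0).
Qed.
End Bezout.

(** * Monomial orders and coefficients of vectors of polynomials *)

Section Coefficients.
Variables (R : comNzRingType) (n r : nat).
Local Notation F := 'rV[{mpoly R[n]}]_r.
Implicit Types (f g : F) (m mu : monomial n r) (v w : 'X_{1..n}).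

(** Coefficients are indexed by the monomials of the free module, so that its
    elements can be handled like polynomials. *)
Definition coefv f m : R := (f 0 m.2)@_m.1.

Lemma coefv0 m : coefv 0 m = 0.
Proof. by rewrite /coefv mxE mcoeff0. Qed.

Lemma coefvD f g m : coefv (f + g) m = coefv f m + coefv g m.
Proof. by rewrite /coefv mxE mcoeffD. Qed.

Lemma coefvB f g m : coefv (f - g) m = coefv f m - coefv g m.
Proof. by rewrite /coefv !mxE mcoeffB. Qed.

Lemma coefv_sum (I : Type) (s : seq I) (P : pred I) (f : I -> F) m :
  coefv (\sum_(i <- s | P i) f i) m = \sum_(i <- s | P i) coefv (f i) m.
Proof.
exact: (big_morph (coefv^~ m) (fun f g => coefvD f g m) (coefv0 m)).
Qed.

Definition mon_dvd m mu : bool := (m.2 == mu.2) && (m.1 <= mu.1)%MM.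

Definition mon_div mu m : 'X_{1..n} := (mu.1 - m.1)%MM.

Lemma mon_dvdP m mu : mon_dvd m mu -> mon_mul (mon_div mu m) m = mu.
Proof.
by case: m mu => u i [v j] /andP[/eqP/= -> uv]; rewrite /mon_mul /= submK.
Qed.

Lemma mon_dvd_mull w m : mon_dvd m (mon_mul w m).
Proof. by rewrite /mon_dvd eqxx lem_addl. Qed.

Lemma mon_mulK w m : mon_div (mon_mul w m) m = w.
Proof. by rewrite /mon_div /= addmK. Qed.

Lemma mon_mulA v w m : mon_mul v (mon_mul w m) = mon_mul (v + w)%MM m.
Proof. by rewrite /mon_mul /= addmA. Qed.

Lemma mcoeffXM v (p : {mpoly R[n]}) w :
  ('X_[v] * p)@_w = if (v <= w)%MM then p@_(w - v) else 0.
Proof.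
rewrite mulrC; case: ifP => [vw|/negP vNw].
  by rewrite -{1}(submK vw) addmC mcoeffMX.
apply/eqP; rewrite mcoeff_eq0; apply/negP; rewrite (perm_mem (msuppMX _ _)).
by case/mapP => u _ wE; apply: vNw; rewrite wE lem_addr.
Qed.

Lemma coefvZ (p : {mpoly R[n]}) f m :
  coefv (p *: f) m =
  \sum_(v <- msupp p | (v <= m.1)%MM) p@_v * coefv f ((m.1 - v)%MM, m.2).
Proof.
rewrite /coefv mxE {1}[p]mpolyE mulr_suml (raddf_sum (mcoeff m.1)) /=.
rewrite [RHS]big_mkcond /=; apply: eq_bigr => v _.
by rewrite -scalerAl mcoeffZ mcoeffXM; case: ifP => //; rewrite mulr0.
Qed.

Variable gt : rel (monomial n r).

(** Using an upper bound in place of the leading monomial makes the zero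
    vector and cancelling leading terms unexceptional. *)
Definition bounded f mu : Prop := forall m, gt m mu -> coefv f m = 0.

Hypothesis gt_order : monomial_order gt.

Lemma gt_irr : irreflexive gt. Proof. by case: gt_order => -[]. Qed.
Lemma gt_trans : transitive gt. Proof. by case: gt_order => -[]. Qed.
Lemma gt_total m m' : m != m' -> gt m m' || gt m' m.
Proof. by case: gt_order => -[_ _ tot] _; exact: tot. Qed.
Lemma gt_mul w m m' : gt m m' -> gt (mon_mul w m) (mon_mul w m').
Proof. by case: gt_order => _ [_ gtM]; exact: gtM. Qed.
Lemma gt_asym m m' : gt m m' -> gt m' m = false.
Proof. by move=> mm'; apply/negP => /(gt_trans mm'); rewrite gt_irr. Qed.

(** Only the product of the leading terms can reach mu: a monomial v of p and a
    smaller monomial of f multiply to something below v m. *)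
Lemma coefvZ_lead (p : {mpoly R[n]}) f m mu :
    bounded f m -> (forall v, gt (mon_mul v m) mu -> p@_v = 0) ->
  coefv (p *: f) mu = if mon_dvd m mu then p@_(mon_div mu m) * coefv f m else 0.
Proof.
move=> fm pmu; rewrite coefvZ.
have zero v : (v <= mu.1)%MM -> mon_mul v m != mu ->
    p@_v * coefv f ((mu.1 - v)%MM, mu.2) = 0.
  set u : monomial n r := ((mu.1 - v)%MM, mu.2) => v_mu vm.
  have vu : mon_mul v u = mu.
    by rewrite /mon_mul /u /= addmC submK //; case: (mu).
  have [um|] := boolP (gt u m); first by rewrite fm ?mulr0.
  have: u != m by apply: contraNneq vm => <-; rewrite vu.
  move=> /gt_total/orP[->//|/(gt_mul v)]; rewrite vu => /pmu->.
  by rewrite mul0r.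
case: ifP => [m_mu|/negP mNmu]; last first.
  apply: big1 => v /zero; apply; apply/eqP => mE; apply: mNmu.
  by rewrite -mE mon_dvd_mull.
have v_mu : (mon_div mu m <= mu.1)%MM by rewrite /mon_div lem_subr.
have eq_m : ((mu.1 - mon_div mu m)%MM, mu.2) = m.
  by rewrite -(mon_dvdP m_mu) mon_mulK /= addmC addmK; case: (m).
have only v : v != mon_div mu m ->
    (if (v <= mu.1)%MM then p@_v * coefv f ((mu.1 - v)%MM, mu.2) else 0) = 0.
  move=> v_neq; case: ifP => // /zero; apply.
  by apply: contraNneq v_neq => <-; rewrite mon_mulK.
rewrite big_mkcond /=; have [v_p|vNp] := boolP (mon_div mu m \in msupp p).
  rewrite (bigD1_seq _ v_p (msupp_uniq p)) /= v_mu eq_m big1 ?addr0 //.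
rewrite (memN_msupp_eq0 vNp) mul0r big_seq big1 // => v v_p.
by apply: only; apply: contraNneq vNp => <-.
Qed.

Lemma bounded_scale (p : {mpoly R[n]}) f m mu :
    bounded f m -> (forall v, gt (mon_mul v m) mu -> p@_v = 0) ->
  bounded (p *: f) mu.
Proof.
move=> fm pmu u u_mu; rewrite (coefvZ_lead fm); last first.
  by move=> v /gt_trans/(_ u_mu)/pmu.
case: ifP => // /mon_dvdP uE; rewrite pmu ?mul0r //.
by rewrite uE.
Qed.

Lemma bounded_neq f m mu : bounded f mu -> coefv f m != 0 -> m != mu -> gt mu m.
Proof.
move=> fmu fm /gt_total/orP[/fmu fm0|//].
by rewrite fm0 eqxx in fm.
Qed.

Lemma coefv_lead_mon f m :
  lead_mon gt f = Some m -> coefv f m != 0 /\ bounded f m.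
Proof.
move=> /(lead_monP gt_order)[fm m_max]; split=> // m' m'm; apply/eqP.
apply: contraT => /m_max[m'E|]; first by rewrite m'E gt_irr in m'm.
by rewrite (gt_asym m'm).
Qed.

Lemma lead_mon_exists f : f != 0 -> exists m, lead_mon gt f = Some m.
Proof.
by rewrite -(lead_mon_eq0 gt); case: lead_mon => // m _; exists m.
Qed.

Lemma lead_mon_bounded f m :
  coefv f m != 0 -> bounded f m -> lead_mon gt f = Some m.
Proof.
move=> fm f_m; have [|m' m'E] := @lead_mon_exists f.
  by apply: contraNneq fm => ->; rewrite coefv0.
have [fm' f_m'] := coefv_lead_mon m'E; rewrite m'E; congr Some.
apply/eqP; apply: contraNT fm => /gt_total/orP[/f_m m'0|/f_m' ->//].
by rewrite m'0 eqxx in fm'.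
Qed.

Lemma mcoeffZX c v w :
  (c *: 'X_[v] : {mpoly R[n]})@_w = if v == w then c else 0.
Proof. by rewrite mcoeffZ mcoeffX; case: eqP; rewrite ?mulr1 ?mulr0. Qed.

End Coefficients.

(** * Monomial orders are well founded *)

Lemma choice_on (X Y : Type) (P : X -> Prop) (Q : X -> Y -> Prop) (y0 : Y) :
    (forall x, P x -> exists y, Q x y) ->
  exists f : X -> Y, forall x, P x -> Q x (f x).
Proof.
move=> PQ; have [|f fP] := @choice _ _ (fun x y => P x -> Q x y).
  move=> x; have [Px|nPx] := pselect (P x); last by exists y0.
  by have [y Qy] := PQ x Px; exists y.
by exists f.
Qed.

(** Each term of the subsequence is the position of a minimum of f over all
    positions after the preceding one. *)
Lemma nondecreasing_subsequence (f : nat -> nat) :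
  exists phi : nat -> nat, (forall i j, i < j -> phi i < phi j)%N /\
    (forall i j, i <= j -> f (phi i) <= f (phi j))%N.
Proof.
have next k : exists j, (k <= j)%N /\ forall i, (k <= i)%N -> (f j <= f i)%N.
  pose P x := `[< exists2 j, (k <= j)%N & f j = x >].
  have exP : exists x, P x by exists (f k); apply/asboolP; exists k.
  case: (ex_minnP exP) => x /asboolP[j kj <-] f_min; exists j; split=> // i ki.
  by apply: f_min; apply/asboolP; exists i.
have [h hP] := choice next.
pose phi := fix phi k := if k is k'.+1 then h (phi k').+1 else h 0%N.
have phiS k : (phi k < phi k.+1)%N by have [] := hP (phi k).+1.
have phi_lt : {homo phi : i j / (i < j)%N}.
  by apply: homo_ltn => //; exact: ltn_trans.
exists phi; split=> // i j; rewrite leq_eqVlt => /predU1P[->//|ij].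
case: i ij => [|i] ij /=; first by apply: (hP 0%N).2.
by apply: (hP _).2; apply: phi_lt; apply: ltnW.
Qed.

Lemma nondecreasing_subsequences (F : seq (nat -> nat)) :
  exists phi : nat -> nat, (forall i j, i < j -> phi i < phi j)%N /\
    (forall i j k, i <= j -> nth id F k (phi i) <= nth id F k (phi j))%N.
Proof.
elim: F => [|f F [phi [phi_lt phiF]]].
  by exists id; split=> // i j k; rewrite nth_nil.
have [psi [psi_lt psi_f]] := nondecreasing_subsequence (f \o phi).
exists (phi \o psi); split=> [i j /psi_lt/phi_lt//|i j [|k] ij /=].
  exact: psi_f.
apply: phiF; move: ij; rewrite leq_eqVlt => /predU1P[->//|/psi_lt/ltnW//].
Qed.

(** An infinite sequence of monomials is thinned out until the exponent of every
    variable is nondecreasing. *)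
Lemma dickson n r (m : nat -> monomial n r) :
  exists i j, (i < j)%N /\ mon_dvd (m i) (m j).
Proof.
(* An index i and its complement r - i can only both be nondecreasing if i is
   constant; this puts the basis vectors on the same footing as the exponents.
   *)
have [vars varsE] : {vars | vars = enum 'I_n} by exists (enum 'I_n).
pose F := [:: fun i => (m i).2 : nat; fun i => (r - (m i).2)%N] ++
          [seq fun i => (m i).1 l | l <- vars].
have [phi [phi_lt phiF]] := nondecreasing_subsequences F.
exists (phi 0%N), (phi 1%N); split; first exact: phi_lt.
apply/andP; split.
  rewrite -val_eqE eqn_leq (phiF _ _ 0%N) //=.
  have := phiF 0%N 1%N 1%N isT; rewrite /= leq_sub2lE //.
  exact: ltnW.
apply/mnm_lepP => l; have := phiF 0%N 1%N (2 + l)%N isT.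
rewrite /F /= add0n !(nth_map l) varsE ?size_enum_ord //.
by rewrite !nth_ord_enum.
Qed.

(** By Dickson's lemma a strictly decreasing sequence would contain a monomial
    that divides a later, hence smaller, one. *)
Lemma gt_wf n r (gt : rel (monomial n r)) : monomial_order gt ->
  well_founded (fun m m' => gt m' m).
Proof.
move=> gt_order m0; set lt := (X in Acc X); apply: contrapT => m0Nacc.
have [|next nextP] := @choice_on _ _ (fun m => ~ Acc lt m)
    (fun m m' => gt m m' /\ ~ Acc lt m') m0.
  move=> m mNacc; apply: contrapT => noN; apply: mNacc; constructor=> m' mm'.
  by apply: contrapT => m'Nacc; apply: noN; exists m'.
pose m k := iter k next m0.
have mNacc k : ~ Acc lt (m k) by elim: k => // k /nextP[].
have m_gt i j : (i < j)%N -> gt (m i) (m j).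
  apply: (homo_ltn (r := gt)) => [|k]; first exact: gt_trans.
  by have [] := nextP _ (mNacc k).
have [i [j [/m_gt ij /mon_dvdP]]] := dickson m.
have [->|w_neq0] := eqVneq (mon_div (m j) (m i)) 0%MM.
  rewrite /mon_mul add0m -surjective_pairing => mE.
  by rewrite mE (gt_irr gt_order) in ij.
case: (gt_order) => _ [/(_ _ (m i) w_neq0) + _] mE; rewrite mE.
by rewrite (gt_asym gt_order).
Qed.

(** * Division and Schreyer orders *)

Definition is_submodule (S : nzRingType) (V : lmodType S) (U : V -> Prop) :=
  U 0 /\ forall a u v, U u -> U v -> U (a *: u + v).

Section LeadBasis.
Variables (R : comNzRingType) (n r : nat).
Local Notation F := 'rV[{mpoly R[n]}]_r.
Implicit Types (L : seq (F * monomial n r)) (U : F -> Prop).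

Definition lead_gens L mu : R^o -> Prop := fun c =>
  exists l, [/\ l \in L, mon_dvd l.2 mu & c = coefv l.1 l.2].

(** A Groebner basis whose leading coefficients are nonzerodivisors: each
    element is listed with its leading monomial, and the initial module is
    described by its ideal of coefficients at every monomial. *)
Definition lead_basis (gt : rel (monomial n r)) U L : Prop :=
  (forall l, l \in L ->
    [/\ U l.1, bounded gt l.1 l.2 & GRing.lreg (coefv l.1 l.2)]) /\
  (forall f mu, U f -> bounded gt f mu ->
    span (lead_gens L mu) (coefv f mu)).

Definition free_vars s L : Prop :=
  forall l, l \in L -> forall k : 'I_n, (k < s)%N -> l.2.1 k = 0%N.

Definition gen L (k : 'I_(size L)) : F := (tnth (in_tuple L) k).1.
Definition gen_mon L (k : 'I_(size L)) : monomial n r :=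
  (tnth (in_tuple L) k).2.
Definition gen_coef L (k : 'I_(size L)) : R := coefv (gen k) (gen_mon k).
Definition gen_mx L : 'M[{mpoly R[n]}]_(size L, r) :=
  \matrix_(k < size L) gen k.

Lemma mulmx_gen L (h : 'rV_(size L)) : h *m gen_mx L = \sum_k h 0 k *: gen k.
Proof. by rewrite mulmx_sum_row; apply: eq_bigr => k _; rewrite rowK. Qed.

Lemma lead_gens_family L mu c : span (lead_gens L mu) c ->
  exists b : 'I_(size L) -> R,
    c = \sum_(k | mon_dvd (gen_mon k) mu) b k * gen_coef k.
Proof.
apply: (@span_family R R^o _ _ (fun k => mon_dvd (@gen_mon L k) mu)) => x.
case=> l [/(tnthP (in_tuple L))[k lE] l_mu ->].
by exists k; rewrite /gen_coef /gen /gen_mon -lE.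
Qed.

Variables (gt : rel (monomial n r)) (U : F -> Prop).
Variable L : seq (F * monomial n r).
Hypotheses (gt_order : monomial_order gt) (U_mod : is_submodule U).
Hypothesis L_basis : lead_basis gt U L.
Implicit Types (j k : 'I_(size L)) (h : 'rV[{mpoly R[n]}]_(size L)).

Lemma gen_in k : U (gen k).
Proof. by case: L_basis => /(_ _ (mem_tnth k (in_tuple L)))[]. Qed.

Lemma gen_bounded k : bounded gt (gen k) (gen_mon k).
Proof. by case: L_basis => /(_ _ (mem_tnth k (in_tuple L)))[]. Qed.

Lemma gen_coef_reg k : GRing.lreg (gen_coef k).
Proof. by case: L_basis => /(_ _ (mem_tnth k (in_tuple L)))[]. Qed.

Lemma mulmx_gen_in h : U (h *m gen_mx L).
Proof.
case: U_mod => U0 UZD; rewrite mulmx_gen.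
by elim/big_rec: _ => // k u _; apply: UZD; apply: gen_in.
Qed.

Lemma coefv_mulmx_gen h mu :
    (forall v k, gt (mon_mul v (gen_mon k)) mu -> coefv h (v, k) = 0) ->
  coefv (h *m gen_mx L) mu = \sum_(k | mon_dvd (gen_mon k) mu)
    coefv h (mon_div mu (gen_mon k), k) * gen_coef k.
Proof.
move=> h_mu; rewrite mulmx_gen coefv_sum [RHS]big_mkcond /=.
apply: eq_bigr => k _; rewrite (coefvZ_lead gt_order (@gen_bounded k)) //.
by move=> v /h_mu.
Qed.

Lemma bounded_mulmx_gen h mu :
    (forall v k, gt (mon_mul v (gen_mon k)) mu -> coefv h (v, k) = 0) ->
  bounded gt (h *m gen_mx L) mu.
Proof.
move=> h_mu m m_mu; rewrite mulmx_gen coefv_sum big1 // => k _.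
by apply: (bounded_scale gt_order (@gen_bounded k)) m_mu => v /h_mu.
Qed.

(** The coefficient vector by which an R-linear combination of leading
    coefficients is realised at the monomial mu: each generator in P is first
    multiplied up to have leading monomial mu. *)
Definition comb (P : pred 'I_(size L)) (b : 'I_(size L) -> R)
    (mu : monomial n r) : 'rV[{mpoly R[n]}]_(size L) :=
  \row_k (if P k then b k *: 'X_[mon_div mu (gen_mon k)] else 0).

Lemma coefv_comb P b mu v k :
  coefv (comb P b mu) (v, k) =
  if P k && (mon_div mu (gen_mon k) == v) then b k else 0.
Proof.
by rewrite /coefv mxE /=; case: ifP => _; rewrite ?mcoeff0 ?mcoeffZX.
Qed.

Section Comb.
Variables (P : pred 'I_(size L)) (b : 'I_(size L) -> R) (mu : monomial n r).
Hypothesis P_mu : forall k, P k -> mon_dvd (gen_mon k) mu.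

Lemma comb_support v k :
  coefv (comb P b mu) (v, k) != 0 -> P k /\ mon_mul v (gen_mon k) = mu.
Proof.
rewrite coefv_comb; case: ifP => [/andP[Pk /eqP<-] _|_]; last by rewrite eqxx.
by split; rewrite ?mon_dvdP ?P_mu.
Qed.

Lemma comb_small v k :
  gt (mon_mul v (gen_mon k)) mu -> coefv (comb P b mu) (v, k) = 0.
Proof.
move=> gt_mu; apply/eqP; apply: contraTT gt_mu => /comb_support[_ ->].
by rewrite (gt_irr gt_order).
Qed.

Lemma coefv_comb_mulmx :
  coefv (comb P b mu *m gen_mx L) mu = \sum_(k | P k) b k * gen_coef k.
Proof.
rewrite coefv_mulmx_gen; last exact: comb_small.
rewrite big_mkcond [RHS]big_mkcond; apply: eq_bigr => k _ /=.
rewrite coefv_comb eqxx andbT; case: (boolP (P k)) => [/P_mu->//|_].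
by rewrite mul0r if_same.
Qed.

Lemma bounded_comb_mulmx : bounded gt (comb P b mu *m gen_mx L) mu.
Proof. exact/bounded_mulmx_gen/comb_small. Qed.
End Comb.

(** The leading term of f is cancelled by a combination of multiples of the
    generators, and the process stops because the order is well founded.  The
    second conclusion is the standard-representation property: no summand has
    a leading monomial above that of f. *)
Lemma division f : U f -> exists h, f = h *m gen_mx L /\
  forall v k, coefv h (v, k) != 0 -> exists2 m, coefv f m != 0 &
    m = mon_mul v (gen_mon k) \/ gt m (mon_mul v (gen_mon k)).
Proof.
have [f0|f_neq0] := eqVneq f 0.
  move=> _; exists 0; rewrite mul0mx; split=> // v k.
  by rewrite coefv0 eqxx.
have [mu] := lead_mon_exists gt f_neq0.
elim/(well_founded_ind (gt_wf gt_order)): mu f {f_neq0} => mu IHmu f f_mu Uf.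
have [fmu f_bd] := coefv_lead_mon gt_order f_mu.
have [b bE] := lead_gens_family (L_basis.2 f mu Uf f_bd).
pose h1 := comb (fun k => mon_dvd (gen_mon k) mu) b mu.
pose f' := f - h1 *m gen_mx L.
have Uf' : U f'.
  rewrite /f' addrC -scaleN1r; case: U_mod => _; apply=> //.
  exact: mulmx_gen_in.
have f'_bd : bounded gt f' mu.
  move=> m m_mu; rewrite coefvB f_bd // bounded_comb_mulmx ?subr0 //.
have f'mu : coefv f' mu = 0 by rewrite coefvB coefv_comb_mulmx // -bE subrr.
have h1P v k : coefv h1 (v, k) != 0 -> mon_mul v (gen_mon k) = mu.
  by case/comb_support.
have [f'0|/(lead_mon_exists gt)[mu' f'mu']] := eqVneq f' 0.
  exists h1; split; first by apply/eqP; rewrite -subr_eq0 -/f' f'0.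
  by move=> v k /h1P vk; exists mu; [|left].
have f'_lt m : coefv f' m != 0 -> gt mu m.
  move=> f'm; apply: (bounded_neq gt_order f'_bd f'm).
  by apply: contraNneq f'm => ->; rewrite f'mu.
have [f'mu'_neq0 _] := coefv_lead_mon gt_order f'mu'.
have [h2 [f'E h2P]] := IHmu mu' (f'_lt _ f'mu'_neq0) f' f'mu' Uf'.
exists (h1 + h2); split; first by rewrite mulmxDl -f'E addrC subrK.
move=> v k; have [h1vk|/h1P vk _] := eqVneq (coefv h1 (v, k)) 0; last first.
  by exists mu; [|left].
rewrite coefvD h1vk add0r => /h2P[m /f'_lt mu_m m_vk]; exists mu; rewrite //.
by right; case: m_vk => [<-//|]; apply: (gt_trans gt_order).
Qed.

Lemma gen_mx_span u : U u <-> exists h, u = h *m gen_mx L.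
Proof.
split=> [/division[h [uE _]]|[h ->]]; first by exists h.
exact: mulmx_gen_in.
Qed.

Variable prec : rel 'I_(size L).
Hypotheses (prec_irr : irreflexive prec) (prec_trans : transitive prec).
Hypothesis prec_total : forall j k, j != k -> prec j k || prec k j.

(** The order of Schreyer on the free module on the generators: w e_j is
    compared through the leading monomial of w g_j, and prec decides ties. *)
Definition schreyer : rel (monomial n (size L)) := fun x y =>
  let x' := mon_mul x.1 (gen_mon x.2) in let y' := mon_mul y.1 (gen_mon y.2) in
  gt x' y' || (x' == y') && prec x.2 y.2.

Lemma schreyer_order : monomial_order schreyer.
Proof.
split; split.
- by move=> x; rewrite /schreyer (gt_irr gt_order) prec_irr andbF.
- move=> y x z /orP[xy|/andP[/eqP xy pxy]] /orP[yz|/andP[/eqP yz pyz]].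
  + by rewrite /schreyer (gt_trans gt_order xy yz).
  + by rewrite /schreyer -yz xy.
  + by rewrite /schreyer xy yz.
  + by rewrite /schreyer xy yz eqxx (prec_trans pxy pyz) orbT.
- move=> [v j] [w k] neq; rewrite /schreyer /=.
  have [eq_m|/(gt_total gt_order)] :=
      eqVneq (mon_mul v (gen_mon j)) (mon_mul w (gen_mon k)); last first.
    by case/orP=> ->; rewrite ?orbT.
  rewrite eq_m (gt_irr gt_order) /=; apply: prec_total.
  apply: contraNneq neq => jk; move: eq_m; rewrite jk => /(congr1 fst).
  by move/addIm->.
- move=> w [v j] w_neq0; rewrite /schreyer /= -mon_mulA.
  by case: (gt_order) => _ [-> //].
- move=> w x y /orP[xy|/andP[/eqP xy pxy]]; rewrite /schreyer /= -!mon_mulA.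
    by rewrite (gt_mul gt_order w xy).
  by rewrite xy eqxx pxy orbT.
Qed.

Definition after_gens j mu : R^o -> Prop := fun c =>
  exists k, [/\ prec j k, mon_dvd (gen_mon k) mu & c = gen_coef k].

(** In the image of h, the coefficient at mu = w m_j collects the contributions
    of the monomials v e_k with v m_k = mu.  Those with k before j are above
    (w, j), so they vanish; the rest expresses the j-th one by the later
    generators. *)
Lemma syzygy_lead h w j :
    h *m gen_mx L = 0 -> bounded schreyer h (w, j) ->
  span (after_gens j (mon_mul w (gen_mon j))) (coefv h (w, j) * gen_coef j).
Proof.
set mu := mon_mul w (gen_mon j) => h0 h_bd.
have := coefv_mulmx_gen (h := h) (mu := mu); rewrite h0 coefv0 => /(_ _)/esym.
rewrite (bigD1 j) ?mon_dvd_mull //= mon_mulK => sum0.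
rewrite -[X in span _ X]opprK (addr0_eq (sum0 _)); last first.
  by move=> v k gt_mu; apply: h_bd; rewrite /schreyer /= gt_mu.
rewrite -(@scaleN1r R R^o); apply/spanZ/span_sum => k /andP[k_mu k_neq].
have [kj|jk] := orP (prec_total k_neq); last first.
  by apply: spanZ; apply: span_mem; exists k.
rewrite h_bd ?mul0r; first exact: span0.
by rewrite /schreyer /= mon_dvdP // eqxx kj orbT.
Qed.

(** A relation a c_j = sum of b_k c_k over T gives a combination of the g's in
    which the coefficient at mu cancels.  Dividing the result by the g's uses
    only terms below mu, and the difference is a syzygy with leading term
    a w e_j. *)
Lemma syzygy_exists j (T : {set 'I_(size L)}) (w : 'X_{1..n}) (a : R) :
    let mu := mon_mul w (gen_mon j) in
    (forall k, k \in T -> prec j k && mon_dvd (gen_mon k) mu) ->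
    span (fun c : R^o => c \in [seq gen_coef k | k <- enum T])
      (a * gen_coef j) ->
  exists h, [/\ h *m gen_mx L = 0, bounded schreyer h (w, j) &
                coefv h (w, j) = a].
Proof.
move=> mu T_mu span_a.
have [b bE] : exists b : 'I_(size L) -> R,
    a * gen_coef j = \sum_(k in T) b k * gen_coef k.
  apply: (@span_family R R^o _ _ (mem T)) span_a => c /mapP[k].
  by rewrite mem_enum => kT ->; exists k.
have jNT : j \notin T by apply/negP => /T_mu; rewrite prec_irr.
pose h0 := comb (mem (j |: T)) (fun k => if k == j then a else - b k) mu.
have jT_mu k : k \in j |: T -> mon_dvd (gen_mon k) mu.
  by case/setU1P => [->|/T_mu/andP[]//]; apply: mon_dvd_mull.
have h0_bd := bounded_comb_mulmx (fun k => if k == j then a else - b k) jT_mu.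
have h0mu : coefv (h0 *m gen_mx L) mu = 0.
  rewrite coefv_comb_mulmx // big_setU1 //= eqxx bE -big_split big1 //= => k kT.
  by rewrite (negPf (memPn jNT k kT)) mulNr subrr.
have [h [hE hP]] := division (mulmx_gen_in h0).
have h_mu v k : coefv h (v, k) != 0 -> gt mu (mon_mul v (gen_mon k)).
  case/hP=> m h0m m_vk; have mu_m : gt mu m.
    apply: (bounded_neq gt_order h0_bd h0m).
    by apply: contraNneq h0m => ->; rewrite h0mu.
  by case: m_vk => [<-//|]; apply: (gt_trans gt_order).
exists (h0 - h); split; first by rewrite mulmxBl hE subrr.
- case=> v k vk_wj; rewrite coefvB.
  have [-> | h_neq0] := eqVneq (coefv h (v, k)) 0; last first.
    case/orP: vk_wj => [/(gt_asym gt_order)|/andP[/eqP vk _]].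
      by rewrite h_mu.
    by have := h_mu _ _ h_neq0; rewrite /= in vk; rewrite vk (gt_irr gt_order).
  rewrite subr0; apply/eqP; apply: contraTT vk_wj => /(comb_support jT_mu).
  case=> k_jT vk; rewrite /schreyer /= vk (gt_irr gt_order) eqxx /=.
  case/setU1P: k_jT => [->|/T_mu/andP[jk _]]; first by rewrite prec_irr.
  by apply/negP => /(prec_trans jk); rewrite prec_irr.
rewrite coefvB coefv_comb /mu mon_mulK inE setU11 !eqxx /=.
have [->|/h_mu] := eqVneq (coefv h (w, j)) 0; first by rewrite subr0.
by rewrite (gt_irr gt_order).
Qed.

(** When no two leading monomials share a basis vector, the ideals in
    syzygy_lead are all zero. *)
Lemma syzygy_eq0 h :
    injective (fun k => (gen_mon k).2) -> h *m gen_mx L = 0 -> h = 0.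
Proof.
move=> inj h0; apply/eqP; apply: contraT => /(lead_mon_exists schreyer)[[w j]].
case/(coefv_lead_mon schreyer_order) => h_neq0 /(syzygy_lead h0) h_span.
have after0 c : span (after_gens j (mon_mul w (gen_mon j))) c -> c = 0.
  move: c; apply: span_least => [//|a u v -> ->|c].
    by rewrite scaler0 addr0.
  by case=> k [jk /andP[/eqP/inj kj _] _]; rewrite kj prec_irr in jk.
move/after0: h_span => /eqP; rewrite mulrC (mulrI_eq0 _ (@gen_coef_reg j)).
by rewrite (negPf h_neq0).
Qed.
End LeadBasis.

(** * Iterated syzygies *)

(** The tie-breaking order: e will be the exponent of the variable that is to
    disappear from the next leading monomials, which requires that it never
    increases along the order. *)
Definition by_degree (t : nat) (e : 'I_t -> nat) : rel 'I_t :=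
  fun j k => (e k < e j)%N || ((e k == e j) && (j < k)%N).

Section ByDegree.
Variables (t : nat) (e : 'I_t -> nat).

Lemma by_degree_irr : irreflexive (by_degree e).
Proof. by move=> j; rewrite /by_degree !ltnn andbF. Qed.

Lemma by_degree_trans : transitive (by_degree e).
Proof.
move=> k j l /orP[jk|/andP[/eqP jk j_k]] /orP[kl|/andP[/eqP kl k_l]];
  rewrite /by_degree.
- by rewrite (ltn_trans kl jk).
- by rewrite kl jk.
- by rewrite -jk kl.
- by rewrite kl jk eqxx (ltn_trans j_k k_l) orbT.
Qed.

Lemma by_degree_total j k : j != k -> by_degree e j k || by_degree e k j.
Proof.
rewrite /by_degree -val_eqE neq_ltn /=.
by case: (ltngtP (e j) (e k)) => //= _.
Qed.
End ByDegree.

Section Steps.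
Variables (R : comNzRingType) (bezR : bezout_ring R) (n : nat).
Local Notation S := {mpoly R[n]}.

(** One step of the resolution.  The ideal at w e_j depends only on the set T
    of those k after j for which m_k divides w m_j, so a basis of the
    syzygies is indexed by the pairs (j, T), at the least w such that all m_k
    with k in T divide w m_j.  The variable of index s does not occur in that
    w, because its exponent does not increase from m_j to m_k. *)
Lemma syzygy_step r (gt : rel (monomial n r)) (U : 'rV[S]_r -> Prop) L s :
    monomial_order gt -> is_submodule U -> lead_basis gt U L -> free_vars s L ->
  exists (gt' : rel (monomial n (size L))) L',
    [/\ monomial_order gt', lead_basis gt' (fun h => h *m gen_mx L = 0) L' &
        free_vars s.+1 L'].
Proof.
move=> gt_order U_mod L_basis L_free.
(* The value 0 covers the case where no variable is left. *)
pose e (j : 'I_(size L)) := if insub s is Some k then (gen_mon j).1 k else 0%N.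
pose prec := by_degree e.
have prec_irr : irreflexive prec := @by_degree_irr _ e.
have prec_trans : transitive prec := @by_degree_trans _ e.
have prec_total j k : j != k -> prec j k || prec k j.
  exact: by_degree_total.
pose P (x : 'I_(size L) * {set 'I_(size L)}) := (x.2 != set0) &&
  [forall k in x.2, prec x.1 k && ((gen_mon k).2 == (gen_mon x.1).2)].
pose w (x : 'I_(size L) * {set 'I_(size L)}) : 'X_{1..n} :=
  [multinom (\max_(k in x.2) ((gen_mon k).1 l - (gen_mon x.1).1 l))%N | l < n].
pose cs (T : {set 'I_(size L)}) := [seq gen_coef k | k <- enum T].
pose Q x (h : 'rV[S]_(size L)) := [/\ h *m gen_mx L = 0,
  bounded (schreyer gt prec) h (w x, x.1), GRing.lreg (coefv h (w x, x.1)) &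
  forall a, span (fun c : R^o => c \in cs x.2) (a * gen_coef x.1) ->
  exists y, a = y * coefv h (w x, x.1)].
have [|h hP] := @choice_on _ _ P Q 0.
  move=> [j T] /andP[/= T_neq0 /forall_inP T_P].
  have [|_ /mapP[k _ ->]||a [a_reg a_span a_dvd]] :=
    @bezout_colon _ bezR (cs T) (gen_coef j).
  - have [k kT] := set0Pn _ T_neq0; apply/eqP => csT.
    have : gen_coef k \in cs T by apply: map_f; rewrite mem_enum.
    by rewrite csT.
  - exact: gen_coef_reg L_basis k.
  - exact: gen_coef_reg L_basis j.
  have [|h [h0 h_bd h_lead]] := syzygy_exists gt_order U_mod L_basis prec_irr
      prec_trans _ a_span (w := w (j, T)).
    move=> k kT; have /andP[-> /eqP k2] := T_P k kT.
    rewrite /mon_dvd k2 eqxx /=.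
    by apply/mnm_lepP => l; rewrite mnmDE mnmE addnC -leq_subLR (bigmax_sup k).
  by exists h; split; rewrite ?h_lead.
exists (schreyer gt prec).
exists [seq (h x, (w x, x.1)) | x <- enum P].
split; first exact: schreyer_order.
- split=> [_ /mapP[x + ->]|f [v j] f0 f_bd].
    by rewrite mem_enum => /hP[h0 h_bd h_reg _].
  have f_span := syzygy_lead gt_order L_basis prec_total f0 f_bd.
  pose T := [set k | prec j k && mon_dvd (gen_mon k) (mon_mul v (gen_mon j))].
  have {}f_span :
      span (fun c : R^o => c \in cs T) (coefv f (v, j) * gen_coef j).
    move: f_span; apply: span_least; first exact: span0.
      by move=> *; apply: spanZD.
    move=> c [k [jk kv ->]]; apply: span_mem; apply: map_f.
    by rewrite mem_enum inE jk kv.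
  (* If T is empty, the ideal is zero, and so is its quotient by c_j. *)
  have [T0|T_neq0] := eqVneq T set0.
    have : coefv f (v, j) * gen_coef j = 0.
      have cs0 c : span (fun c : R^o => c \in cs T) c -> c = 0.
        move: c; apply: span_least => [//|a x y -> ->|c].
          by rewrite scaler0 addr0.
        by rewrite /cs T0 enum_set0.
      exact: cs0.
    move/eqP; rewrite mulrC (mulrI_eq0 _ (gen_coef_reg L_basis (k := j))).
    move=> /eqP->.
    exact: span0.
  have Px : P (j, T).
    rewrite /P T_neq0; apply/forall_inP => k.
    by rewrite inE => /andP[-> /andP[]].
  have [_ _ _ /(_ _ f_span)[y ->]] := hP _ Px.
  apply: spanZ; apply: span_mem; exists (h (j, T), (w (j, T), j)); split=> //.
    by apply/mapP; exists (j, T); rewrite ?mem_enum.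
  rewrite /mon_dvd eqxx /=; apply/mnm_lepP => l; rewrite mnmE.
  apply/bigmax_leqP => k.
  rewrite inE => /andP[_ /andP[_ /mnm_lepP/(_ l)]].
  by rewrite mnmDE addnC -leq_subLR.
move=> _ /mapP[[j T] + ->] l.
rewrite mem_enum => /andP[_ /forall_inP/= T_P] l_s /=.
rewrite mnmE; apply/eqP; rewrite -leqn0; apply/bigmax_leqP => k /T_P/andP[jk _].
rewrite leqn0 subn_eq0; move: l_s; rewrite ltnS leq_eqVlt => /orP[/eqP l_s|l_s].
  move: jk; rewrite /prec /by_degree /e -l_s valK.
  by case/orP => [/ltnW//|/andP[/eqP-> _]].
by rewrite (L_free _ (mem_tnth k (in_tuple L)) l l_s).
Qed.

(** Without variables in the leading monomials, the ideal of leading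
    coefficients at u e_i does not depend on u.  It is principal, so at most
    one element for each basis vector e_i is enough. *)
Lemma lead_basis_constant r (gt : rel (monomial n r)) (U : 'rV[S]_r -> Prop) L :
    monomial_order gt -> is_submodule U -> lead_basis gt U L -> free_vars n L ->
  exists L', lead_basis gt U L' /\
    injective (fun k : 'I_(size L') => (gen_mon k).2).
Proof.
move=> gt_order U_mod L_basis L_free.
pose P (i : 'I_r) := has (fun l => l.2.2 == i) L.
have L_const (k : 'I_(size L)) : gen_mon k = (0%MM, (gen_mon k).2).
  rewrite [LHS]surjective_pairing; congr (_, _); apply/mnmP => x; rewrite mnm0E.
  exact: (L_free _ (mem_tnth k (in_tuple L)) x).
pose basis_mon i : monomial n r := (0%MM, i).
pose Q i (f : 'rV[S]_r) := [/\ U f, bounded gt f (basis_mon i),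
  GRing.lreg (coefv f (basis_mon i)) &
  forall k : 'I_(size L), (gen_mon k).2 = i ->
  exists y, gen_coef k = y * coefv f (basis_mon i)].
have [|g gP] := @choice_on _ _ P Q 0.
  move=> i /hasP[l /(tnthP (in_tuple L))[k0 ->] /eqP k0_i].
  pose Pi (k : 'I_(size L)) := (gen_mon k).2 == i.
  have [d [d_span d_dvd]] := bezout_seq bezR [seq gen_coef k | k in Pi].
  have {}d_dvd (k : 'I_(size L)) :
      (gen_mon k).2 = i -> exists y, gen_coef k = y * d.
    by move=> /eqP k_i; apply: d_dvd; apply/imageP; exists k.
  have [b bE] : exists b : 'I_(size L) -> R,
    d = \sum_(k | Pi k) b k * gen_coef k.
    apply: (@span_family R R^o _ _ Pi) d_span => c /imageP[k k_i ->].
    by exists k.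
  have top_dvd (k : 'I_(size L)) : Pi k -> mon_dvd (gen_mon k) (basis_mon i).
    by move=> /eqP <-; rewrite [X in mon_dvd X]L_const /mon_dvd eqxx lepm_refl.
  exists (comb Pi b (basis_mon i) *m gen_mx L).
  rewrite /Q (coefv_comb_mulmx gt_order L_basis) // -bE; split=> //.
  - exact: (mulmx_gen_in U_mod L_basis).
  - exact: (bounded_comb_mulmx gt_order L_basis).
  have [y k0E] := d_dvd k0 k0_i; have := gen_coef_reg L_basis (k := k0).
  by rewrite k0E; apply: GRing.lregMl.
pose L' := [seq (g i, basis_mon i) | i <- enum P]; exists L'.
have L'P (l : _ * _) : l \in L' -> P l.2.2 /\ l = (g l.2.2, basis_mon l.2.2).
  by case/mapP => i; rewrite mem_enum => Pi ->.
split; first split.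
- by move=> l /L'P[/gP[Ug g_bd g_reg _] ->].
- move=> f mu Uf f_bd; have := L_basis.2 f mu Uf f_bd.
  apply: span_least; first exact: span0.
    by move=> *; apply: spanZD.
  move=> _ [l [lL /andP[/eqP l_mu _] ->]].
  have Pmu : P mu.2 by apply/hasP; exists l; rewrite ?l_mu.
  have [k kE] := tnthP (in_tuple L) _ lL.
  have [_ _ _ /(_ k)[|y yE]] := gP _ Pmu; first by rewrite /gen_mon -kE.
  rewrite kE -[coefv _ _]/(gen_coef k) yE.
  apply: spanZ; apply: span_mem; exists (g mu.2, basis_mon mu.2); split=> //.
    by apply/mapP; exists mu.2; rewrite ?mem_enum.
  by rewrite /mon_dvd eqxx; apply/mnm_lepP => x; rewrite mnm0E.
move=> j k /= jk; apply/val_inj/eqP.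
have L'_uniq : uniq L'.
  by rewrite map_inj_uniq ?enum_uniq // => i i' /(congr1 (fun l => l.2.2)).
pose l0 := tnth (in_tuple L') j.
rewrite -(nth_uniq l0 (ltn_ord j) (ltn_ord k) L'_uniq).
rewrite -![nth l0 L' _](tnth_nth l0 (in_tuple L')).
have [_ ->] := L'P _ (mem_tnth j (in_tuple L')).
have [_ ->] := L'P _ (mem_tnth k (in_tuple L')).
by move: jk; rewrite /gen_mon => ->.
Qed.

(** A resolution of U by p free modules.  Encoding the maps as matrices keeps
    the recursion on syzygies among submodules of free modules. *)
Fixpoint resolved (p r : nat) (U : 'rV[S]_r -> Prop) : Prop :=
  if p is p'.+1 then exists t (G : 'M[S]_(t, r)),
    (forall u, U u <-> exists h, u = h *m G) /\
    resolved p' (fun h : 'rV_t => h *m G = 0)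
  else forall u, U u <-> u = 0.

Lemma ker_submodule t r (G : 'M[S]_(t, r)) :
  is_submodule (fun h : 'rV_t => h *m G = 0).
Proof.
split=> [|a u v u0 v0]; first by rewrite mul0mx.
by rewrite mulmxDl -scalemxAl u0 v0 scaler0 addr0.
Qed.

(** Induction on the number p of variables that may still occur in the leading
    monomials. *)
Lemma lead_basis_resolved p r (gt : rel (monomial n r))
    (U : 'rV[S]_r -> Prop) L :
    monomial_order gt -> is_submodule U -> lead_basis gt U L ->
    (p <= n)%N -> free_vars (n - p) L ->
  resolved p.+1 U.
Proof.
elim: p r gt U L => [|p IHp] r gt U L gt_order U_mod L_basis p_n L_free.
  rewrite subn0 in L_free.
  have [L' [L'_basis L'_inj]] :=
    lead_basis_constant gt_order U_mod L_basis L_free.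
  exists (size L'), (gen_mx L'); split.
    exact: (gen_mx_span gt_order U_mod L'_basis).
  pose e (k : 'I_(size L')) := 0%N.
  move=> h; split=> [|->]; last by rewrite mul0mx.
  exact: (syzygy_eq0 gt_order L'_basis (@by_degree_irr _ e)
    (@by_degree_trans _ e) (@by_degree_total _ e)).
have [gt' [L' [gt'_order L'_basis L'_free]]] :=
  syzygy_step gt_order U_mod L_basis L_free.
exists (size L), (gen_mx L); split.
  exact: (gen_mx_span gt_order U_mod L_basis).
apply: (IHp _ gt' _ L') => //; first exact: ker_submodule.
  exact: ltnW.
by rewrite -subSn ?subSS in L'_free.
Qed.
End Steps.

(** * From Groebner bases to free resolutions *)

Section GroebnerBasis.
Variables (R : comNzRingType) (n r : nat) (gt : rel (monomial n r)).
Hypothesis gt_order : monomial_order gt.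
Local Notation F := 'rV[{mpoly R[n]}]_r.

Lemma lcE (f : F) m : lead_mon gt f = Some m -> lc gt f = coefv f m.
Proof. by rewrite /lc => ->; case: m. Qed.

Lemma coefv_LT (f : F) m mu : lead_mon gt f = Some m ->
  coefv (LT gt f) mu = if mu == m then coefv f m else 0.
Proof.
move=> f_m; rewrite /LT (lcE f_m) f_m; case: m mu f_m => [u i] [v j] _.
rewrite /coefv !mxE eqxx xpair_eqE /=; have [_|_] := eqVneq j i.
  by rewrite mulr1 andbT mcoeffZX eq_sym.
by rewrite mulr0 mcoeff0 andbF.
Qed.

(** The leading term of f lies in the module generated by the leading terms of
    G; comparing coefficients at the leading monomial of f gives the ideal
    membership. *)
Lemma groebner_lead_basis (U : submodClosed F) (G : seq F) :
    groebner_basis gt U G -> {in G, forall f, GRing.lreg (lc gt f)} ->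
  exists L, lead_basis gt (fun f => f \in U) L.
Proof.
case=> GU LT_G G_reg; pose L := pmap (fun g => omap (pair g) (lead_mon gt g)) G.
have L_P l : l \in L -> l.1 \in G /\ lead_mon gt l.1 = Some l.2.
  rewrite mem_pmap => /mapP[g gG]; case g_m: (lead_mon gt g) => [m|] //= [->].
  by [].
have G_L g m : g \in G -> lead_mon gt g = Some m -> (g, m) \in L.
  by move=> gG g_m; rewrite mem_pmap; apply/mapP; exists g; rewrite // g_m.
exists L; split=> [l /L_P[lG l_m]|f mu Uf f_bd].
  have [_ l_bd] := coefv_lead_mon gt_order l_m.
  by split; rewrite ?GU // -(lcE l_m); apply: G_reg.
have [-> | f_mu] := eqVneq (coefv f mu) 0; first exact: span0.
have f_lead := lead_mon_bounded gt_order f_mu f_bd.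
have {f_mu f_bd Uf} : LT_module gt (fun f => f \in G) (LT gt f).
  by apply/LT_G/span_mem; exists f.
case=> k [c [x [xG fE]]].
(* The relation between leading terms is read off at the monomial mu. *)
have -> : coefv f mu = coefv (LT gt f) mu by rewrite (coefv_LT _ f_lead) eqxx.
rewrite fE coefv_sum; apply: span_sum => i _.
have [g [gG ->]] := xG i.
have [m g_m] : exists m, lead_mon gt g = Some m.
  apply: lead_mon_exists; apply: contraTneq (lreg_neq0 (G_reg g gG)) => g0.
  have /eqP lead_g : lead_mon gt g == None by rewrite lead_mon_eq0 g0.
  by rewrite /lc lead_g eqxx.
rewrite coefvZ; apply: span_sum => v v_mu; apply: spanZ.
rewrite (coefv_LT _ g_m); case: eqP => [m_E|_]; last exact: span0.
apply: span_mem; exists (g, m); split=> //; first exact: G_L.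
by rewrite -m_E /mon_dvd eqxx /= lem_subr.
Qed.
End GroebnerBasis.

Section Resolution.
Variable S : nzRingType.

Lemma row_is_free t : is_free 'rV[S]_t.
Proof.
exists (fun v : 'rV[S]_t => [exists i : 'I_t, v == delta_mx 0 i]).
split=> [v|s c s_uniq s_delta sum0 x xs].
  rewrite [v]row_sum_delta; apply: span_sum => i _; apply/spanZ/span_mem.
  by apply/existsP; exists i.
have /existsP[i /eqP xE] := s_delta x xs.
have := congr1 (fun v : 'rV[S]_t => v 0 i) sum0.
rewrite mxE summxE (bigD1_seq x) //= big1_seq ?addr0 => [|y /andP[yx ys]].
  by rewrite xE !mxE !eqxx mulr1.
have /existsP[j /eqP yE] := s_delta y ys; rewrite yE !mxE eqxx /=.
case: eqP => [ij|_]; last by rewrite mulr0.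
by rewrite xE yE ij eqxx in yx.
Qed.

Definition cons_module (A : lmodType S) (P : nat -> lmodType S) (i : nat) :
    lmodType S :=
  if i is j.+1 then P j else A.

(** Splices a chain ending in P 0 onto the module A through e. *)
Definition cons_map (A : lmodType S) (P : nat -> lmodType S)
    (d : forall i, {linear P i.+1 -> P i}) (e : {linear P 0%N -> A}) (i : nat) :
    {linear cons_module A P i.+1 -> cons_module A P i} :=
  if i is j.+1 then d j else e.

Lemma row0_eq0 (x : 'rV[S]_0) : x = 0.
Proof. by apply/rowP => -[]. Qed.
End Resolution.

Lemma resolved_chain (R : comNzRingType) n p r
    (U : 'rV[{mpoly R[n]}]_r -> Prop) :
    resolved p U ->
  exists (P : nat -> lmodType {mpoly R[n]})
    (d : forall i, {linear P i.+1 -> P i})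
    (e : {linear P 0%N -> 'rV[{mpoly R[n]}]_r}),
  [/\ forall i, is_free (P i), forall i, (p <= i)%N -> forall x : P i, x = 0,
      forall i, exact_at (d i.+1) (d i), exact_at (d 0%N) e &
      forall u, U u <-> exists x, e x = u].
Proof.
elim: p r U => [|p IHp] r U.
  move=> U0; have eq0 (u v : 'rV[{mpoly R[n]}]_0) : u = v.
    by rewrite [u]row0_eq0 [v]row0_eq0.
  exists (fun=> 'rV_0), (fun=> mulmxr (0 : 'M_(0, 0))).
  exists (mulmxr (0 : 'M_(0, r))).
  split=> [i|i _ x|i y|y|u].
  - exact: row_is_free.
  - exact: eq0.
  - by split=> _; [exists 0|]; apply: eq0.
  - by split=> [_|_]; [exists 0; apply: eq0|rewrite /= mulmx0].
  - split=> [/U0->|[x <-]]; first by exists 0; rewrite /= mulmx0.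
    by apply/U0; rewrite /= mulmx0.
case=> t [G [UE /IHp[P [d [e [P_free P0 d_ex e_ex eE]]]]]].
exists (cons_module 'rV_t P), (cons_map d e), (mulmxr G); split.
- by case=> [|i]; [apply: row_is_free|apply: P_free].
- by case=> // i; apply: P0.
- by case=> [|i]; [apply: e_ex|apply: d_ex].
- by move=> y; apply: eE.
- by move=> u; split=> [/UE[h ->]|[h <-]]; [exists h|apply/UE; exists h].
Qed.

Section ResolvedModule.
Variables (S : nzRingType) (V : lmodType S) (U : submodClosed V).
Fact quotmod_pi_linear : linear (@quotmod_pi S V U).
Proof. by move=> a u v; rewrite quotmod_piD -quotmod_piZ. Qed.
HB.instance Definition _ := GRing.isLinear.Build S V (quotmod U) *:%R
  (@quotmod_pi S V U) quotmod_pi_linear.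
End ResolvedModule.

Section ProductsOfQuotients.
Lemma pid_bezout (A : idomainType) : is_pid A -> bezout_ring A.
Proof.
move=> pidA a b.
have [|x y [s [t ->]] [s' [t' ->]]|c x [s [t ->]]|d dP] :=
    pidA (fun z => exists s t, z = s * a + t * b).
- by exists 0, 0; rewrite !mul0r addr0.
- by exists (s + s'), (t + t'); rewrite !mulrDl addrACA.
- by exists (c * s), (c * t); rewrite mulrDr !mulrA.
have [s [t dE]] : exists s t, d = s * a + t * b.
  by apply/dP; exists 1; rewrite mul1r.
have [u aE] : exists u, a = u * d.
  by apply/dP; exists 1, 0; rewrite mul1r mul0r addr0.
have [v bE] : exists v, b = v * d.
  by apply/dP; exists 0, 1; rewrite mul1r mul0r add0r.
by exists d, s, t, u, v.
Qed.

Lemma surjective_bezout (A B : comNzRingType) (f : {rmorphism A -> B}) :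
  (forall b, exists a, f a = b) -> bezout_ring A -> bezout_ring B.
Proof.
move=> f_surj bezA b b'; have [a <-] := f_surj b; have [a' <-] := f_surj b'.
have [d [x [y [u [v [dE aE a'E]]]]]] := bezA a a'.
exists (f d), (f x), (f y), (f u), (f v).
by split; rewrite -!rmorphM ?[in LHS]dE ?rmorphD // -?aE -?a'E.
Qed.

Lemma principal_quotient_bezout (A : idomainType) (N : A)
    (hN : N \isn't a GRing.unit) :
  is_pid A -> bezout_ring (principal_quotient hN).
Proof.
move=> /pid_bezout.
pose f : {rmorphism A -> principal_quotient hN} :=
  \pi_(principal_quotient hN)%qT.
apply: (@surjective_bezout A (principal_quotient hN) f) => b.
by exists (repr b); apply: reprK.
Qed.

Lemma prod_ring_bezout q (T : 'I_q.+1 -> comNzRingType) :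
  (forall i, bezout_ring (T i)) -> bezout_ring (prod_ring T).
Proof.
move=> bezT a b.
have [w wP] : {w : forall i, T i * T i * T i * T i * T i & forall i,
    let: (d, x, y, u, v) := w i in
    [/\ d = x * a i + y * b i, a i = u * d & b i = v * d]}.
  suff bez i : exists w : T i * T i * T i * T i * T i,
      let: (d, x, y, u, v) := w in
      [/\ d = x * a i + y * b i, a i = u * d & b i = v * d].
    by exists (fun i => sval (cid (bez i))) => i; case: cid.
  by have [d [x [y [u [v eqs]]]]] := bezT i (a i) (b i); exists (d, x, y, u, v).
exists ([ffun i => (w i).1.1.1.1 : T i] : prod_ring T),
  ([ffun i => (w i).1.1.1.2 : T i] : prod_ring T),
  ([ffun i => (w i).1.1.2 : T i] : prod_ring T),
  ([ffun i => (w i).1.2 : T i] : prod_ring T),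
  ([ffun i => (w i).2 : T i] : prod_ring T).
by split; apply/ffunP => i; rewrite !ffunE;
  case: (w i) (wP i) => [[[[d x] y] u] v] [].
Qed.
End ProductsOfQuotients.

Lemma quotient_resolution (R : comNzRingType) n (M : lmodType {mpoly R[n]}) r
    (U : submodClosed 'rV[{mpoly R[n]}]_r) p (phi : {linear quotmod U -> M}) :
  bijective phi -> resolved p (fun f => f \in U) -> has_free_resolution M p.
Proof.
move=> phi_bij /resolved_chain[P [d [e [P_free P0 d_ex e_ex eE]]]].
exists (cons_module 'rV_r P), (cons_map d e), (phi \o @quotmod_pi _ _ U); split.
- by case=> [|i]; [apply: row_is_free|apply: P_free].
- by case=> // i; apply: P0.
- by case=> [|i]; [apply: e_ex|apply: d_ex].
- move=> u; apply: iff_trans (eE u) => /=.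
  rewrite -[u in u \in U]subr0 -quotmod_piE; split=> [phi0|/eqP->].
    by apply/eqP; apply: (bij_inj phi_bij); rewrite phi0 !linear0.
  by rewrite !linear0.
move=> y; have [psi _ psiK] := phi_bij; exists (repr (psi y)).
by rewrite /= quotmod_reprK psiK.
Qed.

(** The resolution of U has n + 1 free modules, and F comes in front. *)
Lemma bezout_free_resolution (R : comNzRingType) n
    (M : lmodType {mpoly R[n]}) r (U : submodClosed 'rV[{mpoly R[n]}]_r)
    (phi : {linear quotmod U -> M}) (gt : rel (monomial n r))
    (G : seq 'rV[{mpoly R[n]}]_r) :
    bezout_ring R -> bijective phi -> monomial_order gt ->
    groebner_basis gt U G -> {in G, forall f, GRing.lreg (lc gt f)} ->
  has_free_resolution M n.+1.
Proof.
move=> bezR phi_bij gt_order G_groebner G_reg.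
have [L L_basis] := groebner_lead_basis gt_order G_groebner G_reg.
apply: (quotient_resolution phi_bij).
apply: (lead_basis_resolved bezR gt_order _ L_basis (leqnn n)).
  by split=> [|a u v Uu Uv]; [apply: rpred0|apply: rpredD => //; apply: rpredZ].
by move=> l _ k; rewrite subnn.
Qed.

Theorem corollary6p6 (q : nat) (A : 'I_q.+1 -> idomainType)
    (N : forall i, A i)
    (hpid : forall i, is_pid (A i))
    (hN : forall i, N i \isn't a GRing.unit)
    (n : nat)
    (R := prod_ring (fun i => principal_quotient (hN i)) : comNzRingType)
    (S := {mpoly R[n]} : nzRingType)
    (M : lmodType S) (hM : finitely_generated M)
    (r : nat) (U : submodClosed 'rV[S]_r)
    (hMU : exists phi : {linear quotmod U -> M}, bijective phi)
    (gt : rel (monomial n r)) (hgt : monomial_order gt)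
    (hG : exists G : seq 'rV[{mpoly R[n]}]_r,
        groebner_basis gt U G /\ {in G, forall f, GRing.lreg (lc gt f)}) :
  exists p : nat, (p <= n.+1)%N /\ has_free_resolution M p.
Proof.
have bezR : bezout_ring R.
  by apply: prod_ring_bezout => i; apply: principal_quotient_bezout.
case: hMU hG => phi phi_bij [G [G_groebner G_reg]]; exists n.+1; split=> //.
exact: bezout_free_resolution bezR phi_bij hgt G_groebner G_reg.
Qed.
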